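(* Given a set $R$ with $n$ elements together with binary operations $\oplus,\odot:R\times R\to R$ given by their Cayley tables, there is a randomized algorithm that decides in time $O(n^2)$ (correctly with high probability) whether $(R,\oplus,\odot)$ is a ring.
   Context: Computation is in the word-RAM model with $O(\log n)$-bit words; the input consists of the $n\times n$ Cayley tables. ''With high probability'' means success probability at least $1-n^{-c}$ for an arbitrarily large constant $c$. *)

(* Defs.v *)
From mathcomp Require Import all_boot all_order all_algebra.

Set Implicit Arguments.
Unset Strict Implicit.
Unset Printing Implicit Defensive.

(* Rings are associative and unital; the one-element ring (1 = 0) is allowed. *)
Definition is_ring (R : Type) (add mul : R -> R -> R) : Prop :=
  [/\ associative add,
      commutative add,
      exists2 zero : R, left_id zero add & forall x, exists y, add y x = zero,
      associative mul /\ (exists2 one : R, left_id one mul & right_id one mul) &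
      left_distributive mul add /\ right_distributive mul add].

(* Word RAM with [w]-bit words.  Words are represented by the naturals below
   [2 ^ w]; every computed value is reduced modulo [2 ^ w].  A machine has
   registers, named by the program text, and a random-access memory addressed
   by the contents of registers, hence with [2 ^ w] reachable cells. *)

Definition wrap (w x : nat) : nat := x %% 2 ^ w.

Inductive binop : Set :=
  BAdd | BSub | BMul | BDiv | BMod | BAnd | BOr | BXor | BShl | BShr.

Definition eval_binop (w : nat) (o : binop) (x y : nat) : nat :=
  wrap w match o with
  | BAdd => x + y
  | BSub => x + 2 ^ w - y
  | BMul => x * y
  | BDiv => x %/ y
  | BMod => x %% y
  | BAnd => Nat.land x y
  | BOr  => Nat.lor x y
  | BXor => Nat.lxor x y
  | BShl => x * 2 ^ y
  | BShr => x %/ 2 ^ y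
  end.

Inductive instr : Set :=
  | Const (d v : nat)               (* r_d := v *)
  | Op (o : binop) (d a b : nat)    (* r_d := r_a o r_b *)
  | Fetch (d a : nat)               (* r_d := M[r_a] *)
  | Store (a b : nat)               (* M[r_a] := r_b *)
  | Rand (d : nat)                  (* r_d := a uniformly random word *)
  | Jump (l : nat)
  | JumpEq (a b l : nat)            (* goto l if r_a = r_b *)
  | JumpLt (a b l : nat)            (* goto l if r_a < r_b *)
  | Halt (answer : bool).

Definition program : Set := seq instr.

Inductive state : Type :=
  | Running (pc : nat) (reg mem : nat -> nat)
  | Halted (answer : bool).

(* One unit-cost step.  [rnd] is a fresh random word, offered at every step and
   used by [Rand] only.  Running past the end of the program halts with the
   answer [false]. *)
Definition step (P : program) (w : nat) (s : state) (rnd : nat) : state :=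
  match s with
  | Halted b => Halted b
  | Running pc reg mem =>
    match nth (Halt false) P pc with
    | Const d v => Running pc.+1 [eta reg with d |-> wrap w v] mem
    | Op o d a b =>
        Running pc.+1 [eta reg with d |-> eval_binop w o (reg a) (reg b)] mem
    | Fetch d a => Running pc.+1 [eta reg with d |-> mem (reg a)] mem
    | Store a b => Running pc.+1 reg [eta mem with reg a |-> reg b]
    | Rand d => Running pc.+1 [eta reg with d |-> rnd] mem
    | Jump l => Running l reg mem
    | JumpEq a b l => Running (if reg a == reg b then l else pc.+1) reg mem
    | JumpLt a b l => Running (if reg a < reg b then l else pc.+1) reg mem
    | Halt b => Halted b
    end
  end.

Definition answer (s : state) : option bool :=
  if s is Halted b then Some b else None.

(* Registers and the memory cells beyond the input are initially zero. *)
Definition init (input : seq nat) : state :=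
  Running 0 (fun=> 0) (nth 0 input).

(* The answer after [T] steps, given the [T] words offered by the random
   source. *)
Definition run (P : program) (w T : nat) (input : seq nat)
    (tape : T.-tuple 'I_(2 ^ w)) : option bool :=
  answer (foldl (step P w) (init input) [seq val r | r <- tape]).

Definition prob_answer (P : program) (w T : nat) (input : seq nat) (b : bool)
    : rat :=
  (#|[set tape : T.-tuple 'I_(2 ^ w) | run P input tape == Some b]|%:R
   / #|{: T.-tuple 'I_(2 ^ w)}|%:R)%R.

(* The elements of [R] are encoded by their ranks [0, ..., n - 1]; tables are
   listed row by row. *)
Definition cayley_table (R : finType) (op : R -> R -> R) : seq nat :=
  [seq val (enum_rank (op x y)) | x <- enum R, y <- enum R].

Definition ring_input (R : finType) (add mul : R -> R -> R) : seq nat :=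
  #|R| :: cayley_table add ++ cayley_table mul.

(* [k] times the number of binary digits of [n]; for [k > 0] every word of the
   input is below [2 ^ word_size k n]. *)
Definition word_size (k n : nat) : nat := k * (trunc_log 2 n).+1.

(* Main.v *)
Require Import Defs.
From mathcomp Require Import all_boot all_order all_algebra zify.
From Stdlib Require Import FunctionalExtensionality.

Set Implicit Arguments.
Unset Strict Implicit.
Unset Printing Implicit Defensive.

(** The algorithm is deterministic.  Once commutativity, zero and opposites are
    checked, grow a chain of subsets S_0 = {0}, S_1, S_2, ... of R: S_(i+1) is
    the closure of S_i under x |-> x + h, for some h outside of S_i.  For every
    x in S_(i+1) and all z in R, check that (x + h) + z = x + (h + z) =
    h + (x + z) and that z(x + h) = zx + zh and (x + h)z = xz + hz.  By induction on i these
    instances imply all associativity and distributivity laws with summands in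
    S_i, so in the end for R.  In a ring the S_i are subgroups, hence double in
    size at each stage, and the checks number sum_i |S_i| * n <= 2 n^2; the
    loop over the pairs (x, h) is cut after 4n iterations, and an unfinished
    chain refutes that R is a ring.  There are at most log n generators h, and
    by distributivity associativity of the product need only be checked on
    triples (g, h, z) with g and h generators. *)

(** * Structured programs and their compilation *)

Inductive cmd : Set :=
  | Skip
  | Prim (i : instr)
  | Seq (c1 c2 : cmd)
  | IfEq (a b : nat) (c1 c2 : cmd)
  | IfLt (a b : nat) (c1 c2 : cmd)
  | For (i b : nat) (c : cmd).

Infix ";;" := Seq (at level 61, right associativity).

Fixpoint csize (c : cmd) : nat :=
  match c with
  | Skip => 0
  | Prim _ => 1
  | Seq c1 c2 => csize c1 + csize c2
  | IfEq _ _ c1 c2 | IfLt _ _ c1 c2 => csize c2 + csize c1 + 2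
  | For _ _ c => csize c + 5
  end.

(* Register 0 is expected to hold the constant 1. *)
Fixpoint compile (c : cmd) (pc : nat) : seq instr :=
  match c with
  | Skip => [::]
  | Prim i => [:: i]
  | Seq c1 c2 => compile c1 pc ++ compile c2 (pc + csize c1)
  | IfEq a b c1 c2 =>
      JumpEq a b (pc + csize c2 + 2) :: compile c2 pc.+1 ++
      Jump (pc + csize c2 + csize c1 + 2) :: compile c1 (pc + csize c2 + 2)
  | IfLt a b c1 c2 =>
      JumpLt a b (pc + csize c2 + 2) :: compile c2 pc.+1 ++
      Jump (pc + csize c2 + csize c1 + 2) :: compile c1 (pc + csize c2 + 2)
  | For i b c =>
      [:: Const i 0, JumpLt i b (pc + 3), Jump (pc + csize c + 5)
        & compile c (pc + 3) ++ [:: Op BAdd i i 0; Jump pc.+1]]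
  end.

Lemma size_compile c pc : size (compile c pc) = csize c.
Proof.
elim: c pc => //= [c1 H1 c2 H2|a b c1 H1 c2 H2|a b c1 H1 c2 H2|i b c H] pc;
  rewrite ?size_cat /= ?size_cat /= ?H1 ?H2 ?H //; lia.
Qed.

(** Convertible to the updates [[eta f with d |-> v]] made by [step], so executing an instruction
    matches its rule by conversion. *)
Definition upd (f : nat -> nat) (d v : nat) : nat -> nat :=
  fun x => if x == d then v else f x.

Lemma upd_upd f d u v : upd (upd f d u) d v = upd f d v.
Proof. by apply: functional_extensionality => x; rewrite /upd; case: eqP. Qed.

Definition frame (D : seq nat) (r r' : nat -> nat) : Prop :=
  forall x, x \notin D -> r' x = r x.

Lemma frame_upd D r r' d v : d \in D -> frame D r r' -> frame D r (upd r' d v).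
Proof.
move=> dD fr x xD; rewrite /upd; case: eqP => [xd|_]; last exact: fr.
by rewrite -xd (negPf xD) in dD.
Qed.

Lemma frame_trans D1 D r1 r2 r3 : frame D1 r2 r3 -> all (mem D) D1 ->
  frame D r1 r2 -> frame D r1 r3.
Proof.
move=> f23 /allP sub f12 x xD; rewrite f23 ?f12 //.
by apply: contra xD => /sub.
Qed.

(* [bound b] bounds the contents of register [b] whenever a loop up to it
   starts. *)
Fixpoint cost (bound : nat -> nat) (c : cmd) : nat :=
  match c with
  | Skip => 0
  | Prim _ => 1
  | Seq c1 c2 => cost bound c1 + cost bound c2
  | IfEq _ _ c1 c2 | IfLt _ _ c1 c2 => cost bound c2 + cost bound c1 + 2
  | For _ b c => bound b * (cost bound c + 3) + 3
  end.

(** * A program logic with time bounds *)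

Section WeakestPrecondition.

Variables (w : nat) (bound : nat -> nat) (Rej : Prop).

Definition assertion := (nat -> nat) -> (nat -> nat) -> Prop.

Definition reaches (P : program) (t : nat) (s : state) (pc' : nat)
    (Q : assertion) : Prop :=
  exists2 t', t' <= t &
    match iter t' (fun s => step P w s 0) s with
    | Halted b => b = false /\ Rej
    | Running pc reg mem => pc = pc' /\ Q reg mem
    end.

Lemma reaches_now P t pc r m (Q : assertion) :
  Q r m -> reaches P t (Running pc r m) pc Q.
Proof. by exists 0. Qed.

Lemma reaches_step P t s s' pc Q : step P w s 0 = s' ->
  reaches P t s' pc Q -> reaches P t.+1 s pc Q.
Proof. by move=> ss' [t' le_t H]; exists t'.+1; rewrite // iterSr ss'. Qed.

Lemma reaches_leq P t t' s pc Q : t <= t' ->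
  reaches P t s pc Q -> reaches P t' s pc Q.
Proof. by move=> le_t [u le_u H]; exists u => //; apply: leq_trans le_t. Qed.

Lemma reaches_trans P t1 t2 s pc1 pc2 (Q1 Q2 : assertion) :
    reaches P t1 s pc1 Q1 ->
    (forall r m, Q1 r m -> reaches P t2 (Running pc1 r m) pc2 Q2) ->
  reaches P (t1 + t2) s pc2 Q2.
Proof.
move=> [u1 le1]; case E: (iter u1 _ s) => [pc r m|b] H1 H2.
  case: H1 => pcE /H2 [u2 le2 H]; exists (u2 + u1); first by lia.
  by rewrite iterD E pcE.
by exists u1; [lia | rewrite E].
Qed.

(** Jump targets are absolute, so the judgement quantifies over the surrounding code to make blocks
    composable. The bound [cost] is part of it, so termination comes with correctness. *)
Definition wp (c : cmd) (Q : assertion) (r m : nat -> nat) : Prop :=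
  forall P1 P2, reaches (P1 ++ compile c (size P1) ++ P2) (cost bound c)
                  (Running (size P1) r m) (size P1 + csize c) Q.

Lemma nth_code P1 i (P2 : program) :
  nth (Halt false) (P1 ++ i :: P2) (size P1) = i.
Proof. by rewrite nth_cat ltnn subnn. Qed.

Lemma wp_conseq c (Q Q' : assertion) r m :
  (forall r' m', Q r' m' -> Q' r' m') -> wp c Q r m -> wp c Q' r m.
Proof.
move=> QQ' H P1 P2; have [t le_t Ht] := H P1 P2; exists t => //; move: Ht.
by case: (iter _ _ _) => [pc r' m' [-> /QQ']|].
Qed.

Lemma wp_skip (Q : assertion) r m : Q r m -> wp Skip Q r m.
Proof. by move=> H P1 P2; rewrite /= addn0; apply: reaches_now. Qed.

Lemma wp_const d v (Q : assertion) r m :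
  v < 2 ^ w -> Q (upd r d v) m -> wp (Prim (Const d v)) Q r m.
Proof.
move=> lt_v H P1 P2; rewrite /= addn1; apply: reaches_step; last first.
  by apply: reaches_now; apply: H.
by rewrite /= nth_code /= /Defs.wrap modn_small.
Qed.

Lemma wp_op o d a b (Q : assertion) r m :
  Q (upd r d (eval_binop w o (r a) (r b))) m -> wp (Prim (Op o d a b)) Q r m.
Proof.
move=> H P1 P2; rewrite /= addn1; apply: reaches_step; last first.
  by apply: reaches_now; apply: H.
by rewrite /= nth_code.
Qed.

Lemma wp_add d a b (Q : assertion) r m : r a + r b < 2 ^ w ->
  Q (upd r d (r a + r b)) m -> wp (Prim (Op BAdd d a b)) Q r m.
Proof.
by move=> lt_w H; apply: wp_op; rewrite /eval_binop /Defs.wrap modn_small.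
Qed.

Lemma wp_mul d a b (Q : assertion) r m : r a * r b < 2 ^ w ->
  Q (upd r d (r a * r b)) m -> wp (Prim (Op BMul d a b)) Q r m.
Proof.
by move=> lt_w H; apply: wp_op; rewrite /eval_binop /Defs.wrap modn_small.
Qed.

Lemma wp_fetch d a (Q : assertion) r m :
  Q (upd r d (m (r a))) m -> wp (Prim (Fetch d a)) Q r m.
Proof.
move=> H P1 P2; rewrite /= addn1; apply: reaches_step; last first.
  by apply: reaches_now; apply: H.
by rewrite /= nth_code.
Qed.

Lemma wp_store a b (Q : assertion) r m :
  Q r (upd m (r a) (r b)) -> wp (Prim (Store a b)) Q r m.
Proof.
move=> H P1 P2; rewrite /= addn1; apply: reaches_step; last first.
  by apply: reaches_now; apply: H.
by rewrite /= nth_code.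
Qed.

Lemma wp_reject (Q : assertion) r m : Rej -> wp (Prim (Halt false)) Q r m.
Proof. by move=> H P1 P2; exists 1; rewrite //= nth_code. Qed.

Lemma wp_seq c1 c2 (Q : assertion) r m :
  wp c1 (wp c2 Q) r m -> wp (c1 ;; c2) Q r m.
Proof.
move=> H P1 P2; rewrite /= addnA -catA.
apply: reaches_trans (H P1 _) _ => r' m' /(_ (P1 ++ compile c1 (size P1)) P2).
by rewrite -catA size_cat size_compile.
Qed.

(** Common to both conditionals: [p] is the outcome of the test made by the jump [j]. The else
    branch [c2] comes first in the code, and only it ends with a jump over the other branch. *)
Lemma wp_if_aux (j : nat -> nat -> nat -> instr) a b (p : bool) c1 c2
    (Q : assertion) r m P1 P2 :
    (forall P w l, nth (Halt false) P (size P1) = j a b l ->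
       step P w (Running (size P1) r m) 0
       = Running (if p then l else (size P1).+1) r m) ->
    (p -> wp c1 Q r m) -> (~~ p -> wp c2 Q r m) ->
  reaches (P1 ++ (j a b (size P1 + csize c2 + 2) :: compile c2 (size P1).+1 ++
      Jump (size P1 + csize c2 + csize c1 + 2)
      :: compile c1 (size P1 + csize c2 + 2)) ++ P2)
    (cost bound c2 + cost bound c1 + 2) (Running (size P1) r m)
    (size P1 + (csize c2 + csize c1 + 2)) Q.
Proof.
move=> jE H1 H2.
apply: (reaches_leq (t := (cost bound c2 + cost bound c1 + 1).+1)); first by lia.
apply: reaches_step.
  by apply: jE; rewrite /= nth_code.
case: p {jE} H1 H2 => [/(_ isT) H1 _|_ /(_ isT) H2].
  move: H1 => /(_ (P1 ++ j a b (size P1 + csize c2 + 2) :: compile c2 (size P1).+1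
     ++ [:: Jump (size P1 + csize c2 + csize c1 + 2)]) P2).
  rewrite size_cat /= size_cat /= size_compile -!catA /= -!catA /=.
  rewrite (_ : size P1 + (csize c2 + 1).+1 = size P1 + csize c2 + 2); last by lia.
  rewrite (_ : size P1 + csize c2 + 2 + csize c1
             = size P1 + (csize c2 + csize c1 + 2)); last by lia.
  by apply: reaches_leq; lia.
apply: (reaches_leq (t := cost bound c2 + 1)); first by lia.
apply: (@reaches_trans _ _ _ _ (size P1 + csize c2 + 1) _ Q).
  move: H2 => /(_ (rcons P1 (j a b (size P1 + csize c2 + 2)))).
  rewrite size_rcons => /(_ (Jump (size P1 + csize c2 + csize c1 + 2)
      :: compile c1 (size P1 + csize c2 + 2) ++ P2)).
  by rewrite cat_rcons addn1 -addSn -?catA /= -?catA.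
move=> r' m' H.
apply: reaches_step; last by apply: reaches_now; apply: H.
have := nth_code (P1 ++ j a b (size P1 + csize c2 + 2) :: compile c2 (size P1).+1)
  (Jump (size P1 + csize c2 + csize c1 + 2))
  (compile c1 (size P1 + csize c2 + 2) ++ P2).
rewrite size_cat /= size_compile -?catA /= -?catA /=.
rewrite (_ : size P1 + (csize c2).+1 = size P1 + csize c2 + 1); last by lia.
by move=> ->; congr Running; lia.
Qed.

Lemma wp_ifeq a b c1 c2 (Q : assertion) r m :
    (r a = r b -> wp c1 Q r m) -> (r a <> r b -> wp c2 Q r m) ->
  wp (IfEq a b c1 c2) Q r m.
Proof.
move=> H1 H2 P1 P2.
apply: (wp_if_aux (j := JumpEq) (p := r a == r b)) => [P w' l|/eqP|/eqP] //.
by move=> /= ->.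
Qed.

Lemma wp_iflt a b c1 c2 (Q : assertion) r m :
    (r a < r b -> wp c1 Q r m) -> (r b <= r a -> wp c2 Q r m) ->
  wp (IfLt a b c1 c2) Q r m.
Proof.
move=> H1 H2 P1 P2.
apply: (wp_if_aux (j := JumpLt) (p := r a < r b)) => [P w' l||] //.
  by move=> /= ->.
by rewrite -leqNgt.
Qed.

(** [J j] is the invariant before pass [j], and [D] lists the registers the body may change. The
    loop itself writes the counter, so [J] must be insensitive to register [i]; the limit in [b] and
    the constant 1 in register 0 must survive the body. *)
Lemma wp_for i b D c N (J : nat -> assertion) (Q : assertion) r0 m0 :
    i \notin D -> b \notin i :: D -> 0 \notin i :: D ->
    r0 b = N -> r0 0 = 1 -> N <= bound b -> N < 2 ^ w ->
    (forall j r m v, J j r m -> J j (upd r i v) m) ->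
    J 0 r0 m0 ->
    (forall j r m, j < N -> frame (i :: D) r0 r -> r i = j -> J j r m ->
       wp c (fun r' m' => frame D r r' /\ J j.+1 r' m') r m) ->
    (forall r m, frame (i :: D) r0 r -> J N r m -> Q r m) ->
  wp (For i b c) Q r0 m0.
Proof.
move=> iD bD oD rb r1 le_N lt_N Jupd J0 body post P1 P2.
set P := P1 ++ _ ++ P2.
have codeE : P = P1 ++ [:: Const i 0, JumpLt i b (size P1 + 3),
    Jump (size P1 + csize c + 5)
    & compile c (size P1 + 3) ++ [:: Op BAdd i i 0, Jump (size P1).+1 & P2]].
  by rewrite /P /= -!catA.
have i0 : nth (Halt false) P (size P1) = Const i 0 by rewrite codeE nth_code.
have i1 : nth (Halt false) P (size P1).+1 = JumpLt i b (size P1 + 3).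
  by rewrite codeE nth_cat ltnNge leqnSn subSnn.
have i2 : nth (Halt false) P (size P1).+2 = Jump (size P1 + csize c + 5).
  rewrite codeE nth_cat ltnNge (leq_trans (leqnSn _)) //=.
  by rewrite -(addn2 (size P1)) addKn.
have i3 : nth (Halt false) P (size P1 + 3 + csize c) = Op BAdd i i 0.
  rewrite codeE nth_cat ltnNge -addnA leq_addr /= addKn /= nth_cat.
  by rewrite size_compile ltnn subnn.
have i4 : nth (Halt false) P (size P1 + 3 + csize c).+1 = Jump (size P1).+1.
  rewrite codeE nth_cat -addnS ltnNge -addnA leq_addr /= addKn /= nth_cat.
  by rewrite size_compile ltnNge leqnSn subSnn.
(* Induction on the number [d] of passes left. A pass costs three steps beyond its body: test,
   increment and jump back; the final 2 pays for the failing test and the exit jump. *)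
have loop d j r m : d + j = N -> frame (i :: D) r0 r -> r i = j -> J j r m ->
    reaches P (d * (cost bound c + 3) + 2) (Running (size P1).+1 r m)
      (size P1 + csize c + 5) Q.
  elim: d j r m => [|d IH] j r m dj fr ri Jr.
    apply: (reaches_step (s' := Running (size P1).+2 r m)).
      by rewrite /= i1 ri fr // rb -dj ltnn.
    apply: reaches_step; first by rewrite /= i2.
    apply: reaches_now; apply: post => //.
    by rewrite -dj.
  have lt_j : j < N by lia.
  apply: (reaches_leq (t := (cost bound c + (2 + (d * (cost bound c + 3) + 2))).+1)).
    by lia.
  apply: (reaches_step (s' := Running (size P1 + 3) r m)).
    by rewrite /= i1 ri fr // rb lt_j.
  apply: reaches_trans.
    move: (body _ _ _ lt_j fr ri Jr)
      => /(_ (P1 ++ [:: Const i 0; JumpLt i b (size P1 + 3);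
                Jump (size P1 + csize c + 5)])
             [:: Op BAdd i i 0, Jump (size P1).+1 & P2]).
    by rewrite size_cat -catA cat_cons /= -codeE; apply.
  move=> r' m' [fr' Jr']; rewrite add2n.
  apply: reaches_step; first by rewrite /= i3.
  apply: reaches_step; first by rewrite /= i4.
  have ri' : r' i = j by rewrite fr'.
  have r1' : r' 0 = 1.
    rewrite fr'; last by move: oD; rewrite inE negb_or => /andP[].
    by rewrite fr.
  rewrite ri' r1' /eval_binop /Defs.wrap modn_small ?addn1; last by lia.
  apply: (IH j.+1); first by lia.
  - apply: frame_upd; first by rewrite inE eqxx.
    by apply: frame_trans fr' _ fr; apply/allP => x xD; rewrite /= inE xD orbT.
  - by rewrite /= eqxx.
  - exact: Jupd.
apply: (reaches_leq (t := (N * (cost bound c + 3) + 2).+1)).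
  by have := leq_mul le_N (leqnn (cost bound c + 3)); rewrite /=; lia.
apply: reaches_step; first by rewrite /= i0 /Defs.wrap mod0n.
rewrite /= addnA; apply: (loop N 0); rewrite ?addn0 //=.
- by apply: frame_upd => //; rewrite inE eqxx.
- by rewrite eqxx.
- exact: Jupd.
Qed.

Lemma wp_require a b (Q : assertion) r m :
    (r a <> r b -> Rej) -> (r a = r b -> Q r m) ->
  wp (IfEq a b Skip (Prim (Halt false))) Q r m.
Proof.
by move=> HR HQ; apply: wp_ifeq => H;
  [apply: wp_skip; apply: HQ | apply: wp_reject; apply: HR].
Qed.

End WeakestPrecondition.

(** * Chains of subgroups *)

Section SubgroupChain.

Variables (R : eqType) (add mul : R -> R -> R) (e : R).
Hypotheses (addC : commutative add) (add0 : left_id e add).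

Lemma addr0 : right_id e add.
Proof. by move=> x; rewrite addC add0. Qed.

Definition distributes_at (x y : R) : Prop := forall z,
  mul z (add x y) = add (mul z x) (mul z y) /\
  mul (add x y) z = add (mul x z) (mul y z).

(* The values of [mul] lie outside of [S] in general, where [add] is not known
   to be associative yet; hence the premise of the last clause. *)
Definition good (S : seq R) : Prop :=
  [/\ e \in S,
      forall x y, x \in S -> y \in S -> add x y \in S,
      forall x y z, x \in S -> y \in S -> add (add x y) z = add x (add y z) &
      associative add ->
        forall x y, x \in S -> y \in S -> distributes_at x y].

(** The first two equations say that the left translations by [x] and by [h] commute and that their
    composite is the translation by [x + h]. *)
Definition checked (x h : R) : Prop :=
  (forall z, add (add x h) z = add x (add h z) /\
             add (add x h) z = add h (add x z)) /\ distributes_at x h.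

(* [E] is being closed under [add^~ h], starting from the good set [B]; its
   first [i] elements are processed. *)
Definition closing (B E : seq R) (h : R) (i : nat) : Prop :=
  [/\ good B, {subset B <= E},
      forall j, j < size E ->
        nth e E j \in B \/ exists2 l, l < j & nth e E j = add (nth e E l) h &
      forall j, j < i ->
        checked (nth e E j) h /\ add (nth e E j) h \in E].

Lemma iter_add_split c k l : associative add ->
  iter (k + l) (add c) e = add (iter k (add c) e) (iter l (add c) e).
Proof. by move=> addA; elim: k => [|k IH] /=; rewrite ?add0 // IH addA. Qed.

(** Every element of [E] acts by left translation as some [s] in [B] followed by [k] translations by
    [h], and every such composite is realized in [E]. Sums of elements of [E] are then computed by
    composing translations. *)
Lemma closing_good B E h : closing B E h (size E) -> good E.
Proof.
move=> [[eB clB assB disB] BE gen chk].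
have chkE x : x \in E -> checked x h /\ add x h \in E.
  by move=> xE; have := chk (index x E); rewrite index_mem nth_index //; apply.
(* Translation by [s] commutes with translation by [h], hence with its iterates. *)
have hcomm s z k : s \in B -> iter k (add h) (add s z) = add s (iter k (add h) z).
  move=> /BE /chkE[[H _] _]; elim: k => //= k ->.
  by have [<- <-] := H (iter k (add h) z).
(* Strong induction on the position of [x] in [E]: it lies in [B] or arises from an earlier element
   by adding [h]. Under associativity of [add], its products split the same way into a product with
   [s] and [k] products with [h]. *)
have repr x : x \in E -> exists2 s, s \in B & exists k,
    (forall z, add x z = add s (iter k (add h) z)) /\
    (associative add -> forall z,
       mul z x = add (mul z s) (iter k (add (mul z h)) e) /\
       mul x z = add (mul s z) (iter k (add (mul h z)) e)).
  move=> xE; rewrite -(nth_index e xE); move: xE; rewrite -index_mem.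
  elim/ltn_ind: (index x E) => j IH ltj.
  case: (gen j ltj) => [jB|[l lt_lj jE]].
    by exists (nth e E j) => //; exists 0; split=> //= _ z; rewrite !addr0.
  have lt_l := ltn_trans lt_lj ltj.
  have [s sB [k [H1 H2]]] := IH _ lt_lj lt_l.
  have [[c1 c2] _] := chkE _ (mem_nth e lt_l).
  exists s => //; exists k.+1; rewrite jE; split=> [z|addA z].
    by have [-> _] := c1 z; rewrite H1 -iterSr.
  have [-> ->] := c2 z; have [-> ->] := H2 addA z.
  by rewrite -!addA /= ![add (iter _ _ _) _]addC.
(* Conversely, [E] is closed under adding [h], so any number of translations by [h] can be
   absorbed. *)
have orbit u m : u \in E -> exists2 v, v \in E &
    (forall z, add v z = add u (iter m (add h) z)) /\
    (associative add -> forall z,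
       mul z v = add (mul z u) (iter m (add (mul z h)) e) /\
       mul v z = add (mul u z) (iter m (add (mul h z)) e)).
  move=> uE; elim: m => [|m [v vE [IH1 IH2]]].
    by exists u => //; split=> //= _ z; rewrite !addr0.
  have [[c1 c2] vhE] := chkE _ vE.
  exists (add v h) => //; split=> [z|addA z].
    by have [-> _] := c1 z; rewrite IH1 -iterSr.
  have [-> ->] := c2 z; have [-> ->] := IH2 addA z.
  by rewrite -!addA /= ![add (iter _ _ _) _]addC.
have sumP x y : x \in E -> y \in E ->
    [/\ add x y \in E, forall z, add (add x y) z = add x (add y z) &
        associative add -> distributes_at x y].
  move=> /repr[s sB [k [Hx Fx]]] /repr[t tB [l [Hy Fy]]].
  have [v vE [Hv Fv]] := orbit (add s t) (k + l) (BE _ (clB _ _ sB tB)).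
  have Hxy z : add x (add y z) = add v z.
    by rewrite Hx Hy hcomm // -iterD -assB.
  (* Evaluate the translations in [Hxy] at [e]. *)
  have xyE : add x y = v.
    by rewrite -[RHS]addr0 -Hxy addr0.
  rewrite xyE; split=> // addA z.
  rewrite /distributes_at xyE.
  have [-> ->] := Fv addA z; have [-> ->] := Fx addA z.
  have [-> ->] := Fy addA z; have [-> ->] := disB addA _ _ sB tB z.
  have addCA a b c d : add (add a b) (add c d) = add (add a c) (add b d).
    by rewrite -!addA; congr add; rewrite !addA (addC b).
  by rewrite !iter_add_split // ![RHS]addCA.
split=> [|x y xE yE|x y z xE yE|addA x y xE yE]; first exact: BE.
- by have [] := sumP x y xE yE.
- by have [] := sumP x y xE yE.
- by have [_ _] := sumP x y xE yE; apply.
Qed.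

(** [E] contains both [B] and its translate by [h], and these are disjoint, as for a subgroup and a
    nontrivial coset. *)
Lemma good_doubles B E h : (forall x, injective (add x)) ->
    good B -> uniq B -> h \notin B ->
    (forall x, x \in B -> x \in E /\ add x h \in E) ->
  2 * size B <= size E.
Proof.
move=> inj [_ clB _ _] uB hB BE.
have uBh : uniq (map (add h) B) by rewrite map_inj_uniq //; apply: inj.
have dis : ~~ has (mem B) (map (add h) B).
  apply/hasPn => _ /mapP[s sB ->]; apply: contra hB => /= hsB.
  have sBB : {subset map (add s) B <= B}.
    by move=> _ /mapP[t tB ->]; apply: clB.
  (* Translation by [s] is injective on the finite [B], hence onto it. So [h + s = s + t] for some
     [t] in [B], and cancelling [s] puts [h] in [B]. *)
  have uBs : uniq (map (add s) B) by rewrite map_inj_uniq //; apply: inj.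
  have [|_] := uniq_min_size uBs sBB; first by rewrite size_map.
  move=> /(_ (add h s)); rewrite hsB => /mapP[t tB].
  by rewrite addC => /inj ->.
rewrite mul2n -addnn -[X in _ + X](size_map (add h)) -size_cat.
apply: uniq_leq_size; first by rewrite cat_uniq uB dis.
move=> x; rewrite mem_cat => /orP[/BE[]//|/mapP[s /BE[_ H] ->]].
by rewrite addC.
Qed.

Lemma checked_unit : (forall x, mul x e = e /\ mul e x = e) -> checked e e.
Proof.
move=> mul0; split=> z; rewrite !add0 //.
by have [-> ->] := mul0 z; rewrite !add0.
Qed.

Lemma good_unit : (forall x, mul x e = e /\ mul e x = e) -> good [:: e].
Proof.
move=> mul0; split=> [|x y|x y z|_ x y]; first by rewrite inE.
- by rewrite !inE => /eqP-> /eqP->; rewrite add0.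
- by rewrite !inE => /eqP-> /eqP->; rewrite !add0.
- by rewrite !inE => /eqP-> /eqP->; have [] := checked_unit mul0.
Qed.

(** The chain starts with the closure of [{e}] under adding [e], already complete: the main loop
    then begins by looking for a true generator. *)
Lemma closing_unit : (forall x, mul x e = e /\ mul e x = e) ->
  closing [:: e] [:: e] e 1.
Proof.
move=> mul0; split=> //; first exact: good_unit.
  by case=> //= _; left; rewrite inE.
by case=> //= _; split; [exact: checked_unit | rewrite add0 inE].
Qed.

Lemma closing_start E h : good E -> closing E E h 0.
Proof. by move=> gE; split=> // j /(mem_nth e); left. Qed.

(** A new element goes to the end of the list, so earlier positions keep their meaning and its
    predecessor stands at index [i]. *)
Lemma closing_step B E h i : i < size E -> closing B E h i ->
  let y := add (nth e E i) h in checked (nth e E i) h ->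
  closing B (if y \in E then E else rcons E y) h i.+1.
Proof.
move=> lt_i [gB BE gen chk] y ck; case: ifP => yE.
  split=> // j; rewrite ltnS leq_eqVlt => /orP[/eqP->|/chk] //.
have nthE j : j < size E -> nth e (rcons E y) j = nth e E j.
  by move=> lt_j; rewrite nth_rcons lt_j.
split=> // [x /BE xE|j|j].
- by rewrite mem_rcons inE xE orbT.
- rewrite size_rcons ltnS leq_eqVlt => /orP[/eqP->|lt_j].
    by right; exists i => //; rewrite (nthE i) // nth_rcons ltnn eqxx.
  rewrite nthE //; case: (gen j lt_j) => [|[l lt_l ->]]; first by left.
  by right; exists l => //; rewrite nthE //; apply: ltn_trans lt_j.
rewrite ltnS leq_eqVlt => /orP[/eqP->|lt_j].
  by rewrite nthE // mem_rcons inE eqxx.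
rewrite nthE ?(ltn_trans lt_j) // mem_rcons inE.
by have [? ->] := chk j lt_j; rewrite orbT.
Qed.

Lemma closing_doneP B E h : closing B E h (size E) ->
  h \in E /\ forall x, x \in B -> x \in E /\ add x h \in E.
Proof.
move=> [[eB _ _ _] BE _ chk].
have memE x : x \in E -> add x h \in E.
  move=> xE; have := chk (index x E).
  by rewrite index_mem nth_index // => /(_ xE)[].
by split=> [|x /BE xE]; [rewrite -[h]add0; apply/memE/BE | split=> //; apply: memE].
Qed.

(** Membership in the closure of [e] and [G] under [add], stated as the induction principle by which
    it is used. *)
Definition spans (G E : seq R) : Prop := forall p : R -> Prop,
  p e -> (forall g, g \in G -> p g) ->
  (forall x y, p x -> p y -> p (add x y)) -> forall x, x \in E -> p x.

Lemma spans_rcons_gen G E h : spans G E -> spans (rcons G h) E.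
Proof.
move=> sp p pe pG padd; apply: sp => // g gG; apply: pG.
by rewrite mem_rcons inE gG orbT.
Qed.

Lemma spans_rcons G E x h : x \in E -> h \in e :: G ->
  spans G E -> spans G (rcons E (add x h)).
Proof.
move=> xE hG sp p pe pG padd y; rewrite mem_rcons inE.
case/orP=> [/eqP->|]; last exact: sp.
apply: (padd); first exact: (sp p pe pG padd _ xE).
by move: hG; rewrite inE => /orP[/eqP->|/pG].
Qed.

(** By distributivity both sides of the associative law are additive in each factor. The law spreads
    from generators to all elements in the middle factor, then in the first one; the last factor is
    arbitrary throughout. *)
Lemma mulA_of_gens G E :
    spans G E -> (forall x, x \in E) ->
    (forall x, mul x e = e /\ mul e x = e) ->
    left_distributive mul add -> right_distributive mul add ->
    (forall g h, g \in G -> h \in G ->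
       forall z, mul (mul g h) z = mul g (mul h z)) ->
  associative mul.
Proof.
move=> sp EP mule mDl mDr ass.
have ass1 g : g \in G -> forall y z, mul (mul g y) z = mul g (mul y z).
  move=> gG y; move: y (EP y).
  apply: (sp (fun y => forall z, mul (mul g y) z = mul g (mul y z)))
    => [z|h hG z|u v Hu Hv z].
  - by have [-> _] := mule g; have [_ ->] := mule z; have [-> _] := mule g.
  - exact: ass.
  - by rewrite mDr !mDl mDr Hu Hv.
move=> x y z; move: x (EP x) y z.
apply: (sp (fun x => forall y z, mul x (mul y z) = mul (mul x y) z))
  => [y z|h hG y z|u v Hu Hv y z].
- by have [_ ->] := mule y; have [_ ->] := mule z; have [_ ->] := mule (mul y z).
- by rewrite ass1.
- by rewrite !mDl Hu Hv.
Qed.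

End SubgroupChain.

Section RingFacts.

Variables (R : Type) (add mul : R -> R -> R).
Hypothesis ringR : is_ring add mul.

Lemma ring_addI : forall x, injective (add x).
Proof.
case: ringR => addA addC [o addo inv] _ _ x y z; have [x' x'x] := inv x.
by move=> /(congr1 (add x')); rewrite !addA x'x !addo.
Qed.

Lemma ring_mul0 e : left_id e add -> forall x, mul x e = e /\ mul e x = e.
Proof.
move=> ade x; case: ringR => addA addC _ _ [mDl mDr].
have idem y : add y y = y -> y = e.
  by move=> yy; apply: (@ring_addI y); rewrite yy addC ade.
by split; apply: idem; [rewrite -mDr ade | rewrite -mDl ade].
Qed.

End RingFacts.

(** For [k] generators in a ring, [2 ^ k <= n]. The weaker bound on [k * k] suffices to test all
    triples of two generators and one element in quadratic time. *)
Lemma sqr_leq_expn2 k n : 2 ^ k <= n -> k * k <= 4 * n.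
Proof.
move=> le_n; apply: leq_trans (leq_mul (leqnn 4) le_n).
elim: k {n le_n} => // k IH; rewrite expnS.
by have := ltn_expl k (isT : 1 < 2); nia.
Qed.

(** The integer square root. With [N = 4 * n] it bounds each of the two nested loops over the
    generators. *)
Lemma ex_sqrt_bound N :
  exists2 s, s * s <= N & forall k, k * k <= N -> k <= s.
Proof.
elim: N => [|N [s le_s max_s]]; first by exists 0 => // [[]].
case: (leqP (s.+1 * s.+1) N.+1) => lt_s.
  by exists s.+1 => // k le_k; have := max_s k.-1; nia.
by exists s; [lia | move=> k le_k; nia].
Qed.

(** * The program *)

Notation assert_eq a b := (IfEq a b Skip (Prim (Halt false))).

(* [r_d := M[r_b + r_x * n + r_y]]; the tables of [add] and [mul] start at the
   addresses in registers 0 and 2.  Register 7 is never written, hence 0, and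
   register 8 will hold the zero of [add]. *)
Definition look (b d x y : nat) : cmd :=
  Prim (Op BMul d x 1) ;; Prim (Op BAdd d d y) ;; Prim (Op BAdd d d b) ;;
  Prim (Fetch d d).

Definition setup : cmd :=
  Prim (Const 0 1) ;; Prim (Fetch 1 7) ;;
  Prim (Op BMul 2 1 1) ;; Prim (Op BAdd 3 2 2) ;;
  Prim (Op BAdd 2 2 0) ;; Prim (Op BAdd 3 3 0) ;;
  Prim (Op BAdd 4 3 1) ;; Prim (Op BAdd 5 4 1) ;;
  Prim (Op BAdd 6 1 1) ;; Prim (Op BAdd 6 6 6).

Definition check_addC : cmd :=
  For 9 1 (For 10 1 (look 0 11 9 10 ;; look 0 12 10 9 ;; assert_eq 11 12)).

(** Register 13 flags that the candidate in register 9 has failed, register 14 that some candidate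
    has succeeded. *)
Definition find_unit (b e : nat) : cmd :=
  Prim (Const 14 0) ;;
  For 9 1
   (Prim (Const 13 0) ;;
    For 10 1
     (look b 11 9 10 ;; IfEq 11 10 Skip (Prim (Const 13 1)) ;;
      look b 11 10 9 ;; IfEq 11 10 Skip (Prim (Const 13 1))) ;;
    IfEq 13 7 (Prim (Op BAdd e 9 7) ;; Prim (Const 14 1)) Skip) ;;
  assert_eq 14 0.

Definition check_opp : cmd :=
  For 9 1
   (Prim (Const 14 0) ;;
    For 10 1 (look 0 11 10 9 ;; IfEq 11 8 (Prim (Const 14 1)) Skip) ;;
    assert_eq 14 0).

Definition check_mul0 : cmd :=
  For 9 1 (look 2 11 9 8 ;; assert_eq 11 8 ;; look 2 11 8 9 ;; assert_eq 11 8).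

(* Registers 22, 17 and 23 hold [x], [h] and [x + h]. *)
Definition check_pair : cmd :=
  For 24 1
   (look 0 25 23 24 ;; look 0 26 17 24 ;; look 0 27 22 26 ;; assert_eq 25 27 ;;
    look 0 26 22 24 ;; look 0 27 17 26 ;; assert_eq 25 27 ;;
    look 2 25 24 23 ;; look 2 26 24 22 ;; look 2 27 24 17 ;;
    look 0 28 26 27 ;; assert_eq 25 28 ;;
    look 2 25 23 24 ;; look 2 26 22 24 ;; look 2 27 17 24 ;;
    look 0 28 26 27 ;; assert_eq 25 28).

(* The array [E] starts at the address in register 4 and has length [r19]; the
   marks of its members start at [r3], the [r20] generators at [r5].  The first
   [r18] members of [E] are processed with the generator [r17], and [r16] is
   the next candidate for a generator. *)
Definition init_chain : cmd :=
  Prim (Op BAdd 22 3 8) ;; Prim (Store 22 0) ;; Prim (Store 4 8) ;;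
  Prim (Const 19 1) ;; Prim (Const 18 1) ;; Prim (Const 20 0) ;;
  Prim (Const 16 0) ;; Prim (Op BAdd 17 8 7).

Definition process_element : cmd :=
  Prim (Op BAdd 22 4 18) ;; Prim (Fetch 22 22) ;; look 0 23 22 17 ;;
  check_pair ;;
  Prim (Op BAdd 25 3 23) ;; Prim (Fetch 26 25) ;;
  IfEq 26 7
   (Prim (Store 25 0) ;; Prim (Op BAdd 25 4 19) ;; Prim (Store 25 23) ;;
    Prim (Op BAdd 19 19 0))
   Skip ;;
  Prim (Op BAdd 18 18 0).

Definition try_generator : cmd :=
  Prim (Op BAdd 25 3 16) ;; Prim (Fetch 26 25) ;;
  IfEq 26 7
   (Prim (Op BAdd 17 16 7) ;; Prim (Op BAdd 25 5 20) ;; Prim (Store 25 16) ;;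
    Prim (Op BAdd 20 20 0) ;; Prim (Const 18 0))
   Skip ;;
  Prim (Op BAdd 16 16 0).

(** One loop flattens the nested ones: each pass processes a pending element of [E] or, if there is
    none, tests the next candidate for a generator. The limit [4 * n] in register 6 allows [2 * n]
    passes for earlier stages, [n] for the current stage and [n] for candidates. *)
Definition build_chain : cmd :=
  init_chain ;;
  For 21 6 (IfLt 18 19 process_element (IfLt 16 1 try_generator Skip)) ;;
  IfLt 18 19 (Prim (Halt false)) Skip ;;
  IfLt 16 1 (Prim (Halt false)) Skip.

(** The test on the squared number of generators precedes the loops, so that the time bound holds on
    inputs that are not rings too. *)
Definition check_mulA : cmd :=
  Prim (Op BMul 25 20 20) ;; IfLt 6 25 (Prim (Halt false)) Skip ;;
  For 29 20
   (Prim (Op BAdd 31 5 29) ;; Prim (Fetch 31 31) ;;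
    For 30 20
     (Prim (Op BAdd 32 5 30) ;; Prim (Fetch 32 32) ;; look 2 33 31 32 ;;
      For 24 1
       (look 2 25 33 24 ;; look 2 26 32 24 ;; look 2 27 31 26 ;;
        assert_eq 25 27))).

Definition ring_test : cmd :=
  setup ;; check_addC ;; find_unit 0 8 ;; check_opp ;; find_unit 2 15 ;;
  check_mul0 ;; build_chain ;; check_mulA.

Definition ring_program : program := compile ring_test 0 ++ [:: Halt true].

(** * Correctness of the ring test *)

Section Correctness.

Variables (R : finType) (add mul : R -> R -> R) (w s : nat).

Notation n := #|R|.
Notation rk x := (nat_of_ord (enum_rank x)).

Hypotheses (n_gt0 : 0 < n) (wP : 2 * (n * n) + 4 * n + 1 < 2 ^ w).
Hypothesis sP : forall k, k * k <= 4 * n -> k <= s.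

(** Loop limits are held only in registers 1, 6 and 20; the default [s] serves register 20, the
    number of generators. *)
Definition bound (b : nat) : nat :=
  if b == 1 then n else if b == 6 then 4 * n else s.

Notation wpr := (wp w bound (~ is_ring add mul)).

Lemma rk_lt (x : R) : rk x < n. Proof. exact: ltn_ord. Qed.

Lemma rk_inj (x y : R) : rk x = rk y -> x = y.
Proof. by move=> /val_inj /enum_rank_inj. Qed.

Lemma rk_ex j : j < n -> exists x : R, rk x = j.
Proof. by move=> lt_j; exists (enum_val (Ordinal lt_j)); rewrite enum_valK. Qed.

Lemma rk_ltS (x y : R) : rk x < (rk y).+1 -> x = y \/ rk x < rk y.
Proof. by rewrite ltnS leq_eqVlt => /orP[/eqP/rk_inj|]; [left|right]. Qed.

Definition consts (r : nat -> nat) : Prop :=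
  [/\ [/\ r 0 = 1, r 1 = n, r 2 = n * n + 1 & r 3 = 2 * (n * n) + 1],
      r 4 = 2 * (n * n) + 1 + n, r 5 = 2 * (n * n) + 1 + n + n,
      r 6 = 4 * n & r 7 = 0].

Lemma consts_frame D r r' : all (leq 8) D -> consts r -> frame D r r' ->
  consts r'.
Proof.
move=> /allP D8 cr fr; rewrite /consts !fr //; by apply/negP => /D8.
Qed.

Definition table (op : R -> R -> R) (m : nat -> nat) (a : nat) : Prop :=
  forall x y, m (rk x * n + rk y + a) = rk (op x y).

Definition tables (m : nat -> nat) : Prop :=
  table add m 1 /\ table mul m (n * n + 1).

Lemma idx_lt (x y : R) : rk x * n + rk y < n * n.
Proof. by move: (rk_lt x) (rk_lt y); clear n_gt0 wP sP; nia. Qed.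

(** Register [d] is overwritten before [b] and [y] are read, hence the two inequalities; it may
    coincide with [x]. *)
Lemma wp_look b op d x y X Y Q r m :
    r 1 = n -> r b <= n * n + 1 -> table op m (r b) ->
    d != b -> d != y -> r x = rk X -> r y = rk Y ->
    Q (upd r d (rk (op X Y))) m ->
  wpr (look b d x y) Q r m.
Proof.
move=> r1 rb tb db dy rx ry HQ; have lt := idx_lt X Y.
have E1 : (b == d) = false by rewrite eq_sym (negPf db).
have E2 : (y == d) = false by rewrite eq_sym (negPf dy).
apply/wp_seq/wp_mul; rewrite ?rx ?r1; first by lia.
apply/wp_seq/wp_add; rewrite /upd eqxx E2 ry; first by lia.
apply/wp_seq/wp_add; rewrite /upd eqxx E1; first by lia.
apply: wp_fetch; rewrite /upd eqxx tb; congr Q: HQ.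
by apply: functional_extensionality => z; rewrite /upd; case: eqP.
Qed.

Lemma wp_addlook d x y X Y Q r m : consts r -> tables m ->
    (0 < d) && (d != y) -> r x = rk X -> r y = rk Y ->
    Q (upd r d (rk (add X Y))) m ->
  wpr (look 0 d x y) Q r m.
Proof.
case=> -[r0 r1 _ _] _ _ _ _ [tA _] /andP[d0 dy] rx ry.
apply: wp_look rx ry => //; rewrite ?r0 //; first by lia.
by rewrite -lt0n.
Qed.

Lemma wp_mullook d x y X Y Q r m : consts r -> tables m ->
    (2 < d) && (d != y) -> r x = rk X -> r y = rk Y ->
    Q (upd r d (rk (mul X Y))) m ->
  wpr (look 2 d x y) Q r m.
Proof.
case=> -[r0 r1 r2 _] _ _ _ _ [_ tM] /andP[d0 dy] rx ry.
by apply: wp_look rx ry => //; rewrite ?r2 //; case: eqP d0 => // ->.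
Qed.

(** A loop over the ranks acts as a universal quantifier: a pass that does not reject establishes
    [Phi] for its element and leaves the memory alone. *)
Lemma wp_forall i D c (Phi : R -> Prop) (Q : assertion) r0 m0 :
    i \notin D -> all (leq 8) (i :: D) -> consts r0 ->
    (forall x r, frame (i :: D) r0 r -> consts r -> r i = rk x ->
       wpr c (fun r' m' => [/\ frame D r r', m' = m0 & Phi x]) r m0) ->
    (forall r, frame (i :: D) r0 r -> consts r -> (forall x, Phi x) -> Q r m0) ->
  wpr (For i 1 c) Q r0 m0.
Proof.
move=> iD D8 cr body post; have [[c0 c1 _ _] _ _ _ _] := cr.
have nD x : x < 8 -> x \notin i :: D by move=> x8; apply/negP => /(allP D8) /=; lia.
apply: (wp_for (D := D) (N := n)
  (J := fun j _ m => m = m0 /\ forall x, rk x < j -> Phi x)) => //.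
- exact: nD.
- exact: nD.
- by lia.
- move=> j r m lt_j fr ri [-> IH]; have [x jE] := rk_ex lt_j.
  rewrite -jE in ri IH *.
  apply: wp_conseq (body x r fr (consts_frame D8 cr fr) ri) => r' m' [fr' -> Hx].
  by split=> //; split=> // y /rk_ltS[->|/IH].
- move=> r m fr [-> H]; apply: post => // [|x]; last exact/H/rk_lt.
  exact: consts_frame fr.
Qed.

(* [F] describes the states in which the search has succeeded. *)
Lemma wp_search i f D c (F : (nat -> nat) -> Prop) (Phi : R -> Prop)
    (Q : assertion) r0 m0 :
    i \notin D -> all (leq 8) (i :: D) -> consts r0 -> f != i ->
    (forall r v, F r -> F (upd r i v)) -> r0 f = 0 ->
    (forall x r, frame (i :: D) r0 r -> consts r -> r i = rk x ->
       wpr c (fun r' m' => [/\ frame D r r', m' = m0 &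
          F r' \/ [/\ F r -> F r', r' f = r f & Phi x]]) r m0) ->
    (forall r, frame (i :: D) r0 r -> consts r ->
       F r \/ r f = 0 /\ (forall x, Phi x) -> Q r m0) ->
  wpr (For i 1 c) Q r0 m0.
Proof.
move=> iD D8 cr fi Fi rf body post; have [[c0 c1 _ _] _ _ _ _] := cr.
have nD x : x < 8 -> x \notin i :: D by move=> x8; apply/negP => /(allP D8) /=; lia.
apply: (wp_for (D := D) (N := n) (J := fun j r m =>
  m = m0 /\ (F r \/ r f = 0 /\ forall x, rk x < j -> Phi x))) => //.
- exact: nD.
- exact: nD.
- by lia.
- move=> j r m v [-> [Fr|[rf0 H]]]; split=> //; first by left; apply: Fi.
  by right; rewrite /upd (negPf fi).
- by split=> //; right.
- move=> j r m lt_j fr ri [-> IH]; have [x jE] := rk_ex lt_j.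
  rewrite -jE in ri IH *.
  apply: wp_conseq (body x r fr (consts_frame D8 cr fr) ri).
  move=> r' m' [fr' -> [Fr'|[FF rf' Hx]]]; split=> //; split=> //; first by left.
  case: IH => [/FF|[rf0 IH]]; [by left | right].
  by rewrite rf' rf0; split=> // y /rk_ltS[->|/IH].
- move=> r m fr [-> H]; apply: post => //; first exact: consts_frame fr.
  case: H => [|[rf0 H]]; [by left | right; split=> // x].
  exact/H/rk_lt.
Qed.

Ltac known := solve [eassumption | reflexivity].
Ltac run_look := apply: wp_seq; first [apply: wp_addlook | apply: wp_mullook];
  [assumption | assumption | by [] | known | known | ].
Ltac frames := do !apply: frame_upd => //.

Lemma check_addC_ok Q r m : consts r -> tables m ->
    (forall r', consts r' -> commutative add -> Q r' m) ->
  wpr check_addC Q r m.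
Proof.
move=> cr tm H.
apply: (wp_forall (D := [:: 10; 11; 12])
  (Phi := fun x => forall y, add x y = add y x)) => // [x r1 fr1 c1 r9|]; last first.
  by move=> r' _ cr'; apply: H.
apply: (wp_forall (D := [:: 11; 12])
  (Phi := fun y => add x y = add y x)) => // y r2 fr2 c2 r10.
have {}r9 : r2 9 = rk x by rewrite fr2.
do 2!run_look.
apply: wp_require => /= [neq [_ addC _ _ _]|/rk_inj eq].
  by apply: neq; rewrite /upd addC.
by split=> //; frames.
Qed.

Definition is_unit_of (op : R -> R -> R) (u : R) : Prop :=
  forall y, op u y = y /\ op y u = y.

(** Two nested searches: the outer one for a unit, the inner one for a counterexample to the current
    candidate. The premise on [look] lets the same proof serve both tables. *)
Lemma find_unit_ok b op e (Q : assertion) r m : consts r -> tables m ->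
    (forall r d x y X Y Q, consts r -> (2 < d) && (d != y) ->
       r x = rk X -> r y = rk Y ->
       Q (upd r d (rk (op X Y))) m -> wpr (look b d x y) Q r m) ->
    8 <= e -> e \notin [:: 9; 10; 11; 13; 14] ->
    (is_ring add mul -> exists u, is_unit_of op u) ->
    (forall u r', consts r' -> frame [:: 9; 10; 11; 13; 14; e] r r' ->
       r' e = rk u -> is_unit_of op u -> Q r' m) ->
  wpr (find_unit b e) Q r m.
Proof.
move=> cr tm wlook e8 eN ring_unit H.
have ltw : 1 < 2 ^ w by lia.
have e9 : (9 == e) = false by apply: contraNF eN => /eqP <-.
have e14 : (14 == e) = false by apply: contraNF eN => /eqP <-.
apply/wp_seq/wp_const; first by lia.
apply: wp_seq.
apply: (wp_search (f := 14) (D := [:: 10; 11; 13; 14; e])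
    (F := fun r => r 14 = 1 /\ exists2 u, r e = rk u & is_unit_of op u)
    (Phi := fun u => ~ is_unit_of op u)) => //.
- by move: eN; rewrite !inE !negb_or => /andP[]; rewrite eq_sym => ->.
- by rewrite /= e8.
- by move=> r1 v [r14 [u re Hu]]; split=> //; exists u; rewrite // /upd eq_sym e9.
- move=> x r1 fr1 c1 r9.
  apply/wp_seq/wp_const; first by lia.
  apply: wp_seq.
  apply: (wp_search (f := 13) (D := [:: 11; 13])
     (F := fun r => r 13 = 1 /\ ~ is_unit_of op x)
     (Phi := fun y => op x y = y /\ op y x = y)) => //.
    move=> y r2 fr2 c2 r10.
    have {}r9 : r2 9 = rk x by rewrite fr2.
    apply: wp_seq; apply: (wlook); [done|done|known|known|].
    apply: wp_seq; apply: wp_ifeq => [/= E1|neq].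
      apply: wp_skip; apply: wp_seq; apply: (wlook); [done|done|known|known|].
      apply: wp_ifeq => [E2|neq].
        apply: wp_skip; split; [by frames|by []|right; split=> //].
        by split; apply: rk_inj; rewrite -r10 ?E1 ?E2.
      apply: wp_const => //; split; [by frames|by []|left; split=> //].
      by move=> /(_ y)[_ E2]; apply: neq; rewrite /upd /= E2 r10.
    apply: wp_const => //.
    apply: wp_seq; apply: (wlook); [done|done|known|known|].
    have nu : ~ is_unit_of op x.
      by move=> /(_ y)[E2 _]; apply: neq; rewrite /upd /= E2 r10.
    apply: wp_ifeq => _; [apply: wp_skip | apply: wp_const => //];
      by split; [by frames|by []|left; split].
  move=> r2 fr2 c2 Hx.
  have c27 : r2 7 = 0 by case: c2.
  have fr12 : frame [:: 10; 11; 13; 14; e] r1 r2.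
    by apply: (frame_trans fr2) => //; frames.
  have r2_9 : r2 9 = rk x by rewrite fr2 /= ?r9.
  case: Hx => [[r13 nu]|[r13 Hx]]; last first.
    apply: wp_ifeq => [_|[]]; last by rewrite r13.
    apply: wp_seq; apply: wp_add; first by rewrite c27 r2_9; have := rk_lt x; lia.
    apply: wp_const => //.
    split=> //.
      by apply: frame_upd => //; apply: frame_upd; rewrite ?inE ?eqxx ?orbT.
    left; split=> //; exists x => //.
    by rewrite /upd eq_sym e14 eqxx c27 addn0.
  apply: wp_ifeq => [|_]; first by rewrite r13 c27.
  apply: wp_skip; split=> //; right; split=> //.
  - move=> [r14 [u re Hu]]; split; first by rewrite fr2.
    exists u => //; rewrite fr2 /upd; last first.
      move: eN; rewrite !inE !negb_or.
      by case: (e == 10); case: (e == 11); case: (e == 13); rewrite ?andbF.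
    by case: eqP => // e13; move: eN; rewrite e13.
  - by rewrite fr2.
- move=> r1 fr1 c1 F1; apply: wp_require => [neq ringR|eq].
    case: F1 => [[r14 _]|[r14 nu]].
      by apply: neq; rewrite r14; case: c1 => -[->].
    by have [u /nu] := ring_unit ringR.
  case: F1 => [[r14 [u re Hu]]|[r14 nu]].
    apply: (H u) => //; apply: (frame_trans fr1) => //=; last by frames.
    by rewrite !inE eqxx !orbT.
  by move: eq; rewrite r14; case: c1 => -[->].
Qed.

(** The zero supplied by [is_ring] need not be [e] a priori; commutativity identifies the two left
    identities. *)
Lemma ring_oppr e : is_ring add mul -> left_id e add ->
  forall x, exists y, add y x = e.
Proof.
move=> [_ addC [o addo inv] _ _] adde x; have [y yx] := inv x.
by exists y; rewrite yx -[LHS]adde addC addo.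
Qed.

Lemma check_opp_ok e Q r m : consts r -> tables m -> r 8 = rk e ->
    left_id e add ->
    (forall r', consts r' -> frame [:: 9; 10; 11; 14] r r' ->
       (forall x, exists y, add y x = e) -> Q r' m) ->
  wpr check_opp Q r m.
Proof.
move=> cr tm r8 adde H.
have ltw : 1 < 2 ^ w by lia.
apply: (wp_forall (D := [:: 10; 11; 14])
  (Phi := fun x => exists y, add y x = e)) => // [x r1 fr1 c1 r9|]; last first.
  by move=> r' fr c'; apply: H.
apply/wp_seq/wp_const; first by lia.
apply: wp_seq.
apply: (wp_search (f := 14) (D := [:: 11; 14])
  (F := fun r => r 14 = 1 /\ exists y, add y x = e)
  (Phi := fun y => add y x <> e)) => //.
  move=> y r2 fr2 c2 r10.
  have {}r9 : r2 9 = rk x by rewrite fr2.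
  have {}r8 : r2 8 = rk e by rewrite fr2 // /upd /= fr1.
  run_look; apply: wp_ifeq => /= [E|neq].
    apply: wp_const => //; split; [by frames|by []|left; split=> //].
    by exists y; apply: rk_inj; move: E; rewrite /upd /= r8.
  apply: wp_skip; split; [by frames|by []|right; split=> //].
  by move=> E; apply: neq; rewrite /upd /= E r8.
move=> r2 fr2 c2 F2; have [[c20 _ _ _] _ _ _ _] := c2.
apply: wp_require => [neq ringR|eq].
  case: F2 => [[r14 _]|[r14 ny]]; first by apply: neq; rewrite r14 c20.
  by have [y /ny] := ring_oppr ringR adde x.
case: F2 => [[r14 Hx]|[r14 _]]; last by move: eq; rewrite r14 c20.
by split=> //; apply: (frame_trans fr2) => //; frames.
Qed.

Lemma check_mul0_ok e Q r m : consts r -> tables m -> r 8 = rk e ->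
    left_id e add ->
    (forall r', consts r' -> frame [:: 9; 11] r r' ->
       (forall x, mul x e = e /\ mul e x = e) -> Q r' m) ->
  wpr check_mul0 Q r m.
Proof.
move=> cr tm r8 adde H.
apply: (wp_forall (D := [:: 11])
  (Phi := fun x => mul x e = e /\ mul e x = e)) => // [x r1 fr1 c1 r9|]; last first.
  by move=> r' fr c'; apply: H.
have {}r8 : r1 8 = rk e by rewrite fr1.
run_look; apply: wp_seq; apply: wp_require => [neq ringR|/= E1].
  have [E _] := ring_mul0 ringR adde x.
  by apply: neq; rewrite /upd /= E r8.
run_look; apply: wp_require => [neq ringR|/= E2].
  have [_ E] := ring_mul0 ringR adde x.
  by apply: neq; rewrite /upd /= E r8.
split=> //; first by frames.
by split; apply: rk_inj; rewrite -r8.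
Qed.

Lemma check_pair_ok x h Q r m : consts r -> tables m ->
    r 22 = rk x -> r 17 = rk h -> r 23 = rk (add x h) ->
    (forall r', consts r' -> frame [:: 24; 25; 26; 27; 28] r r' ->
       checked add mul x h -> Q r' m) ->
  wpr check_pair Q r m.
Proof.
move=> cr tm r22 r17 r23 H.
apply: (wp_forall (D := [:: 25; 26; 27; 28])
  (Phi := fun z => [/\ add (add x h) z = add x (add h z),
     add (add x h) z = add h (add x z),
     mul z (add x h) = add (mul z x) (mul z h) &
     mul (add x h) z = add (mul x z) (mul h z)])) => //; last first.
  by move=> r' fr c' Hz; apply: H => //; split=> z; have [] := Hz z.
move=> z r1 fr1 c1 r24.
have {}r22 : r1 22 = rk x by rewrite fr1.
have {}r17 : r1 17 = rk h by rewrite fr1.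
have {}r23 : r1 23 = rk (add x h) by rewrite fr1.
do 3!run_look; apply: wp_seq; apply: wp_require => [neq ringR|/rk_inj E1].
  by case: ringR => addA _ _ _ _; apply: neq; rewrite /upd /= addA.
do 2!run_look; apply: wp_seq; apply: wp_require => [neq ringR|/rk_inj E2].
  case: ringR => addA addC _ _ _; apply: neq.
  by rewrite /upd /= addA (addC h).
do 4!run_look; apply: wp_seq; apply: wp_require => [neq ringR|/rk_inj E3].
  by case: ringR => _ _ _ _ [mDl mDr]; apply: neq; rewrite /upd /= mDr.
do 4!run_look; apply: wp_require => [neq ringR|/rk_inj E4].
  by case: ringR => _ _ _ _ [mDl mDr]; apply: neq; rewrite /upd /= mDl.
by split=> //; frames.
Qed.

(** Once the size test has passed, [sP] bounds both generator loops by [s]; if it fails, [ringG]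
    refutes that the structure is a ring. *)
Lemma check_mulA_ok (G : seq R) e (Q : assertion) r m : consts r -> tables m ->
    (forall j, j < size G -> m (r 5 + j) = rk (nth e G j)) ->
    r 20 = size G -> size G <= n ->
    (is_ring add mul -> size G * size G <= 4 * n) ->
    (forall r', (forall g h, g \in G -> h \in G ->
        forall z, mul (mul g h) z = mul g (mul h z)) -> Q r' m) ->
  wpr check_mulA Q r m.
Proof.
move=> cr tm mG r20 leG ringG H.
have [[c0 c1 _ _] _ c5 c6 _] := cr.
apply/wp_seq/wp_mul; first by rewrite r20; have := leq_mul leG leG; lia.
set r0 := upd r 25 _.
have cr0 : consts r0 by [].
have r0_20 : r0 20 = size G by [].
have r0_6 : r0 6 = 4 * n by [].
have r0_25 : r0 25 = size G * size G by rewrite /r0 /upd /= r20.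
apply: wp_seq; apply: wp_iflt; rewrite r0_6 r0_25 => le_G.
  by apply: wp_reject => /ringG; rewrite leqNgt le_G.
apply: wp_skip.
apply: (wp_for (D := [:: 24; 25; 26; 27; 30; 31; 32; 33]) (N := size G)
  (J := fun j _ m' => m' = m /\ forall a b, a < j -> b < size G -> forall z,
     mul (mul (nth e G a) (nth e G b)) z
     = mul (nth e G a) (mul (nth e G b) z))) => //.
- exact: sP.
- by lia.
- move=> a r1 _ lt_a fr1 r29 [-> IH].
  have cr1 : consts r1 by apply: consts_frame fr1.
  have [[c10 _ _ _] _ _ _ _] := cr1.
  have r1_20 : r1 20 = size G by rewrite fr1.
  have c15 : r1 5 = r 5 by rewrite fr1.
  set g := nth e G a.
  apply/wp_seq/wp_add; first by rewrite c15 c5 r29; lia.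
  apply/wp_seq/wp_fetch; rewrite upd_upd.
  rewrite (_ : upd _ _ _ _ = r 5 + a); last by rewrite /upd /= c15 r29.
  rewrite mG // -/g.
  set r1' := upd _ _ _.
  apply: (wp_for (D := [:: 24; 25; 26; 27; 32; 33]) (N := size G)
    (J := fun j _ m' => m' = m /\ forall b, b < j -> forall z,
       mul (mul g (nth e G b)) z = mul g (mul (nth e G b) z))) => //.
  + exact: sP.
  + by lia.
  + move=> b r2 _ lt_b fr2 r30 [-> IH2].
    have cr2 : consts r2 by apply: consts_frame fr2.
    have r2_31 : r2 31 = rk g by rewrite fr2.
    have c25 : r2 5 = r 5 by rewrite fr2.
    set h := nth e G b.
    apply/wp_seq/wp_add; first by rewrite c25 c5 r30; lia.
    apply/wp_seq/wp_fetch; rewrite upd_upd.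
    rewrite (_ : upd _ _ _ _ = r 5 + b); last by rewrite /upd /= c25 r30.
    rewrite mG // -/h.
    run_look; set r2' := upd _ _ _.
    apply: (wp_forall (D := [:: 25; 26; 27])
      (Phi := fun z => mul (mul g h) z = mul g (mul h z))) => //.
      move=> z r3 fr3 c3 r24.
      have r33 : r3 33 = rk (mul g h) by rewrite fr3.
      have r32 : r3 32 = rk h by rewrite fr3.
      have r31 : r3 31 = rk g by rewrite fr3.
      do 3!run_look; apply: wp_require => [neq ringR|/rk_inj E].
        by case: ringR => _ _ _ [mA _] _; apply: neq; rewrite /upd /= mA.
      by split=> //; frames.
    move=> r3 fr3 c3 Hz; split.
      by apply: (frame_trans fr3) => //; frames.
    split=> // b'; rewrite ltnS leq_eqVlt => /orP[/eqP->|/IH2] //.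
  + move=> r2 _ fr2 [-> Hb]; split.
      by apply: (frame_trans fr2) => //; frames.
    split=> // a' b; rewrite ltnS leq_eqVlt => /orP[/eqP->|/IH]; [exact: Hb|exact].
- move=> r1 _ fr1 [-> Hz]; apply: H => g h /(nthP e)[a lta <-] /(nthP e)[b ltb <-].
  exact: Hz.
Qed.

(** * Correctness and pace of the chain construction *)

Section Chain.

Variable e : R.
Hypotheses (addC : commutative add) (add0e : left_id e add).
Hypothesis mul0 : forall x, mul x e = e /\ mul e x = e.

(* Base addresses of the marks, of the array [E] and of the generators. *)
Notation aM := (2 * (n * n) + 1).
Notation aE := (aM + n).
Notation aG := (aM + n + n).

Definition stored (E G : seq R) (m : nat -> nat) : Prop :=
  [/\ tables m, forall x, m (aM + rk x) = (x \in E),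
      forall j, j < size E -> m (aE + j) = rk (nth e E j) &
      forall j, j < size G -> m (aG + j) = rk (nth e G j)].

(** The generator [h] may be [e], for the initial stage. In the last clause [h] is an exception
    because it enters [E] only in the course of its own stage. *)
Definition chain (B E G : seq R) (h : R) (i g : nat) : Prop :=
  [/\ closing add mul e B E h i, uniq B /\ uniq E,
      h \in e :: G /\ spans add e G E,
      [/\ i <= size E, g <= n & size G <= g] &
      forall x, rk x < g -> x \in E \/ x = h].

(* Processing all earlier generators took [W] iterations. *)
Definition on_schedule (t : nat) (B E G : seq R) (h : R) (i g : nat) : Prop :=
  exists2 W, t <= W + i + g \/ i = size E /\ g = n &
    W = 0 /\ G = [::] \/
    [/\ h \notin B, W <= 2 * size B & 2 ^ size G <= 2 * size B].

Definition chain_regs (E G : seq R) (h : R) (i g : nat) (r : nat -> nat) :=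
  [/\ consts r, r 19 = size E, r 20 = size G, r 17 = rk h &
      r 18 = i /\ r 16 = g].

(** The schedule is claimed for rings only: it depends on the doubling of the chain, and serves to
    show that an unfinished chain refutes the ring axioms. *)
Definition chain_inv (t : nat) (r m : nat -> nat) : Prop :=
  exists B E G h i g, [/\ chain_regs E G h i g r, stored E G m,
    chain B E G h i g & is_ring add mul -> on_schedule t B E G h i g].

Lemma size_uniq (E : seq R) : uniq E -> size E <= n.
Proof. by move=> /card_uniqP <-; apply: max_card. Qed.

Lemma chain_idle B E G h g : chain B E G h (size E) g ->
  [/\ good add mul e E, h \in E & forall x, rk x < g -> x \in E].
Proof.
move=> [cl _ _ _ cov]; have [hE _] := closing_doneP add0e cl.
split=> // [|x /cov[|->]//]; exact: closing_good cl.
Qed.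

(** At the end of a stage [2 * size B <= size E] by doubling, which turns the bounds in terms of [B]
    into bounds by [size E]. In the initial stage they hold because [e] is in [E]. *)
Lemma on_schedule_idle t B E G h g : is_ring add mul ->
    chain B E G h (size E) g -> on_schedule t B E G h (size E) g ->
  exists2 W, t <= W + size E + g \/ g = n & W <= size E /\ 2 ^ size G <= size E.
Proof.
move=> ringR ch [W tW HW]; exists W; first by case: tW => [|[_]]; [left|right].
have [[eE _ _ _] _ _] := chain_idle ch.
case: ch => cl [uB _] _ _ _; have [_ BE] := closing_doneP add0e cl.
case: HW => [[-> ->]|[hB W2 G2]]; first by split=> //; case: (E) eE.
have [gB _ _ _] := cl.
have dbl := good_doubles addC (ring_addI ringR) gB uB hB BE.
by split; [apply: leq_trans W2 dbl | apply: leq_trans G2 dbl].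
Qed.

(** The tables, marks, [E] and generators occupy disjoint areas; [size E < n] keeps the new cell of
    [E] out of the generators. *)
Lemma stored_rcons E G m y : y \notin E -> size E < n -> stored E G m ->
  stored (rcons E y) G (upd (upd m (aM + rk y) 1) (aE + size E) (rk y)).
Proof.
move=> yE ltE [[tA tM] mM mE mG]; split.
- by split=> x z; have := idx_lt x z; rewrite /upd;
    do 2!(case: eqP => [|_]; first by lia); [rewrite tA | rewrite tM].
- move=> x; rewrite /upd; case: eqP => [|_]; first by have := rk_lt x; lia.
  rewrite eqn_add2l mem_rcons inE; case: eqP => [/rk_inj->|neq]; first by rewrite eqxx.
  by rewrite mM; case: eqP neq => // ->.
- move=> j; rewrite size_rcons ltnS nth_rcons /upd eqn_add2l => le_j.
  case: ltngtP le_j => // lt_j _.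
  by case: eqP => [|_]; [have := rk_lt y; lia | apply: mE].
- move=> j lt_j; rewrite /upd; case: eqP => [|_]; first by lia.
  by case: eqP => [|_]; [have := rk_lt y; lia | apply: mG].
Qed.

Lemma stored_rcons_gen E G m h : size E <= n -> stored E G m ->
  stored E (rcons G h) (upd m (aG + size G) (rk h)).
Proof.
move=> leE [[tA tM] mM mE mG]; split.
- by split=> x z; have := idx_lt x z; rewrite /upd;
    (case: eqP => [|_]; first by lia); [rewrite tA | rewrite tM].
- by move=> x; rewrite /upd; case: eqP => [|_]; [have := rk_lt x; lia | rewrite mM].
- by move=> j lt_j; rewrite /upd; case: eqP => [|_]; [lia | apply: mE].
- move=> j; rewrite size_rcons ltnS nth_rcons /upd eqn_add2l => le_j.
  case: ltngtP le_j => // lt_j _.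
  exact: mG.
Qed.

Definition chain_dom := [:: 16; 17; 18; 19; 20; 22; 23; 24; 25; 26; 27; 28].

Lemma process_element_ok t B E G h i g r m : i < size E ->
    chain_regs E G h i g r -> stored E G m -> chain B E G h i g ->
    (is_ring add mul -> on_schedule t B E G h i g) ->
  wpr process_element
    (fun r' m' => frame chain_dom r r' /\ chain_inv t.+1 r' m') r m.
Proof.
move=> lt_i [cr r19 r20 r17 [r18 r16]] st ch sch.
have [cl [uB uE] [hG sp] [le_i le_g le_G] cov] := ch.
have [[c0 c1 _ c3] c4 _ _ c7] := cr.
have [tm mM mE _] := st; have leE := size_uniq uE.
apply/wp_seq/wp_add; first by rewrite c4 r18; lia.
apply/wp_seq/wp_fetch; rewrite upd_upd.
rewrite (_ : upd _ _ _ _ = aE + i); last by rewrite /upd /= c4 r18.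
set x := nth e E i; rewrite mE // -/x.
have xE : x \in E by apply: mem_nth.
run_look; set y := add x h; apply: wp_seq.
set r1 := upd _ _ _.
apply: (check_pair_ok (x := x) (h := h)) => // r2 c2 fr2 ck.
have r2_18 : r2 18 = i by rewrite fr2.
have r2_19 : r2 19 = size E by rewrite fr2.
have r2_23 : r2 23 = rk y by rewrite fr2.
have fr12 : frame chain_dom r r2 by apply: (frame_trans fr2) => //; frames.
have [[d0 d1 _ d3] d4 _ _ d7] := c2.
have rky := rk_lt y.
apply/wp_seq/wp_add; first by rewrite d3 r2_23; lia.
apply/wp_seq/wp_fetch.
rewrite (_ : upd _ _ _ _ = aM + rk y); last by rewrite /upd /= d3 r2_23.
rewrite mM.
set r3 := upd _ _ _.
have r3_25 : r3 25 = aM + rk y by rewrite /r3 /upd /= d3 r2_23.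
have clS := closing_step lt_i cl ck; rewrite -/y in clS.
(* The pass count and the number of processed elements advance together. *)
have schS E' : size E <= size E' -> is_ring add mul ->
    on_schedule t.+1 B E' G h i.+1 g.
  move=> leE' /sch [W [tW|[iE _]] HW]; last by lia.
  by exists W; first by left; lia.
apply: wp_seq; apply: wp_ifeq => [/= r26|neq]; last first.
  have yE : y \in E by move: neq; rewrite /r3 /upd /= d7; case: (y \in E).
  rewrite yE in clS.
  apply: wp_skip; apply: wp_add; first by rewrite /r3 /upd /= r2_18 d0; lia.
  split; first by frames.
  exists B, E, G, h, i.+1, g; split=> //; last exact: schS.
  by split=> //; rewrite /r3 /upd /= ?r2_18 ?d0 ?addn1 ?fr2.
have yE : y \notin E by move: r26; rewrite /r3 /upd /= d7; case: (y \in E).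
rewrite (negPf yE) in clS.
have ltE : size E < n.
  have /size_uniq : uniq (rcons E y) by rewrite rcons_uniq yE.
  by rewrite size_rcons.
apply/wp_seq/wp_store/wp_seq/wp_add; first by rewrite /r3 /upd /= d4 r2_19; lia.
apply/wp_seq/wp_store.
set r4 := upd r3 25 _.
have r4_25 : r4 25 = aE + size E by rewrite /r4 /r3 /upd /= d4 r2_19.
apply: wp_add; first by rewrite /r4 /r3 /upd /= r2_19 d0; lia.
apply: wp_add; first by rewrite /r4 /r3 /upd /= r2_18 d0; lia.
split; first by frames.
exists B, (rcons E y), G, h, i.+1, g; split.
- split=> //; rewrite /r4 /r3 /upd /= ?r2_18 ?r2_19 ?d0 ?addn1 ?size_rcons ?fr2 //.
- rewrite r4_25 r3_25.
  rewrite (_ : r4 23 = rk y) // (_ : r3 0 = 1) //.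
  exact: stored_rcons.
- split=> //; first by rewrite rcons_uniq yE.
  + by split=> //; apply: spans_rcons.
  + by rewrite size_rcons ltnS.
  + by move=> z /cov[zE|]; [left; rewrite mem_rcons inE zE orbT|right].
- by apply: schS; rewrite size_rcons.
Qed.

Lemma try_generator_ok t B E G h g r m : g < n ->
    chain_regs E G h (size E) g r -> stored E G m -> chain B E G h (size E) g ->
    (is_ring add mul -> on_schedule t B E G h (size E) g) ->
  wpr try_generator
    (fun r' m' => frame chain_dom r r' /\ chain_inv t.+1 r' m') r m.
Proof.
move=> lt_g [cr r19 r20 r17 [r18 r16]] st ch sch.
have [gE hE cov] := chain_idle ch.
have [cl [uB uE] [hG sp] [_ le_g le_G] _] := ch.
have [[c0 c1 _ c3] c4 c5 _ c7] := cr.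
have [tm mM _ _] := st; have leE := size_uniq uE.
have [c cE] := rk_ex lt_g.
apply/wp_seq/wp_add; first by rewrite c3 r16; lia.
apply/wp_seq/wp_fetch.
rewrite (_ : upd _ _ _ _ = aM + rk c); last by rewrite /upd /= c3 r16 cE.
rewrite mM; set r1 := upd _ _ _; apply: wp_seq; apply: wp_ifeq => [r26|neq].
  have cE' : c \notin E by move: r26; rewrite /r1 /upd /= c7; case: (c \in E).
  apply/wp_seq/wp_add; first by rewrite /r1 /upd /= r16 c7; lia.
  apply/wp_seq/wp_add; first by rewrite /r1 /upd /= c5 r20; lia.
  apply/wp_seq/wp_store/wp_seq/wp_add; first by rewrite /r1 /upd /= r20 c0; lia.
  apply: wp_const; first by lia.
  apply: wp_add; first by rewrite /r1 /upd /= r16 c0; lia.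
  split; first by frames.
  (* A new stage: the completed [E] becomes the base, with none of its elements yet processed with
     [c]. *)
  exists E, E, (rcons G c), c, 0, g.+1; split.
  - by split=> //; rewrite /r1 /upd /= ?r16 ?c0 ?c7 ?r20 ?size_rcons ?addn1 ?addn0 ?cE.
  - rewrite (_ : upd _ _ _ _ = aG + size G); last by rewrite /r1 /upd /= c5 r20.
    rewrite (_ : upd _ _ _ _ = rk c); last by rewrite /r1 /upd /= r16 cE.
    exact: stored_rcons_gen.
  - split=> //; first exact: closing_start.
    + by split; [rewrite !inE mem_rcons inE eqxx orbT | apply: spans_rcons_gen].
    + by rewrite size_rcons.
    + by move=> x; rewrite -cE => /rk_ltS[->|]; [right | rewrite cE => /cov; left].
  - move=> ringR; have [W tW [W1 G1]] := on_schedule_idle ringR ch (sch ringR).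
    (* The finished stage took [size E] passes. As [W <= size E], the new total is at most twice the
       size of the new base. *)
    exists (W + size E); first by left; case: tW; lia.
    right; split=> //; first by lia.
    by rewrite size_rcons expnS leq_mul2l.
have cE' : c \in E by move: neq; rewrite /r1 /upd /= c7; case: (c \in E).
apply: wp_skip; apply: wp_add; first by rewrite /r1 /upd /= r16 c0; lia.
split; first by frames.
exists B, E, G, h, (size E), g.+1; split=> //.
- by split=> //; rewrite /r1 /upd /= r16 c0 addn1.
- split=> //; first by split=> //; lia.
  by move=> x; rewrite -cE => /rk_ltS[->|]; [left | rewrite cE => /cov; left].
- move=> /sch [W tW HW]; exists W => //.
  by case: tW => [|[_ gn]]; [left; lia | move: lt_g; rewrite gn ltnn].
Qed.

(** If work remains, then [4 * n <= W + i + g] with [W <= 2 * n], [i <= n] and [g <= n]; so all are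
    equalities, and the work is finished after all. *)
Lemma on_schedule_end B E G h i g : chain B E G h i g ->
  on_schedule (4 * n) B E G h i g -> i = size E /\ g = n.
Proof.
move=> [_ [uB uE] _ [le_i le_g _] _] [W [tW|//] HW].
have := size_uniq uB; have := size_uniq uE.
by case: HW => [[W0 _]|[_ W2 _]]; lia.
Qed.

Lemma build_chain_ok (Q : assertion) r m : consts r -> tables m ->
    (forall a, 2 * (n * n) < a -> m a = 0) -> r 8 = rk e ->
    (forall r' m' E G, consts r' -> stored E G m' -> r' 20 = size G ->
       good add mul e E -> (forall x, x \in E) -> spans add e G E ->
       size G <= n -> (is_ring add mul -> size G * size G <= 4 * n) ->
       Q r' m') ->
  wpr build_chain Q r m.
Proof.
move=> cr tm m0 r8 H; have [[c0 c1 _ c3] c4 _ c6 c7] := cr.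
have rke := rk_lt e; apply: wp_seq.
apply/wp_seq/wp_add; first by rewrite c3 r8; lia.
apply/wp_seq/wp_store/wp_seq/wp_store.
apply/wp_seq/wp_const; first by lia.
apply/wp_seq/wp_const; first by lia.
apply/wp_seq/wp_const; first by lia.
apply/wp_seq/wp_const; first by lia.
apply: wp_add; first by rewrite /upd /= r8 c7; lia.
set r1 := upd _ 17 _; set m1 := upd _ _ _.
(* The initial stores amount to inserting [e] into an empty chain. *)
have st1 : stored [:: e] [::] m1.
  have st0 : stored [::] [::] m by split=> // x; rewrite m0 //; lia.
  have -> : m1 = upd (upd m (aM + rk e) 1) (aE + 0) (rk e).
    by rewrite /m1 /upd /= c3 c4 r8 c0 addn0.
  exact: (stored_rcons (E := [::])).
have c1' : consts r1 by [].
apply: wp_seq; apply: (wp_for (D := chain_dom) (N := 4 * n) (J := chain_inv)) => //.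
- by lia.
- exists [:: e], [:: e], [::], e, 1, 0; split=> //.
  + by split=> //; rewrite /r1 /upd /= r8 c7 addn0.
  + split=> //; first exact: closing_unit.
    by split=> [|p pe _ _ x]; rewrite inE // => /eqP->.
  + by exists 0; [left | left].
- move=> t r2 m2 lt_t fr2 r21 [B [E [G [h [i [g [rg st ch sch]]]]]]].
  have [cr2 r19 _ _ [r18 r16]] := rg.
  have [[_ d1 _ _] _ _ _ _] := cr2.
  apply: wp_iflt; rewrite r18 r19 => lt_i.
    exact: process_element_ok lt_i rg st ch sch.
  have [_ _ _ [le_i _ _] _] := ch.
  have iE : i = size E by lia.
  rewrite iE in rg ch sch.
  apply: wp_iflt; rewrite r16 d1 => lt_g.
    exact: try_generator_ok rg st ch sch.
  apply: wp_skip; split=> //.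
  (* The chain is complete, so the pass is idle and the second alternative of the schedule takes
     over. *)
  exists B, E, G, h, (size E), g; split=> // /sch [W tW HW].
  by exists W => //; right; have [_ _ _ [_ le_g _] _] := ch; lia.
- move=> r2 m2 _ [B [E [G [h [i [g [rg st ch sch]]]]]]].
  have [cr2 r19 r20 _ [r18 r16]] := rg.
  have [[_ d1 _ _] _ _ _ _] := cr2.
  have [_ _ [_ sp] [le_i le_g le_G] _] := ch.
  apply: wp_seq; apply: wp_iflt; rewrite r18 r19 => lt_i.
    by apply: wp_reject => /sch /(on_schedule_end ch) [iE _]; lia.
  apply: wp_skip; apply: wp_iflt; rewrite r16 d1 => lt_g.
    by apply: wp_reject => /sch /(on_schedule_end ch) [_ gE]; lia.
  have iE : i = size E by lia.
  rewrite iE in ch sch; have [gE _ cov] := chain_idle ch.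
  apply: wp_skip; apply: (H _ _ E G) => //.
  + by move=> x; apply: cov; have := rk_lt x; lia.
  + by lia.
  + move=> ringR; have [W _ [_ G2]] := on_schedule_idle ringR ch (sch ringR).
    apply: sqr_leq_expn2; apply: leq_trans G2 _.
    by apply: size_uniq; have [_ []] := ch.
Qed.

End Chain.

Lemma setup_ok (Q : assertion) r m : r 7 = 0 -> m 0 = n ->
  (forall r', consts r' -> Q r' m) -> wpr setup Q r m.
Proof.
move=> r7 m0 H.
apply/wp_seq/wp_const; first by lia.
apply/wp_seq/wp_fetch; rewrite (_ : upd _ _ _ _ = 0) // m0.
apply/wp_seq/wp_mul; first by move: wP; rewrite /upd /=; lia.
do 6!(apply/wp_seq/wp_add; first by move: wP; rewrite /upd /=; lia).
apply: wp_add; first by move: wP; rewrite /upd /=; lia.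
by apply: H; split; [split|..]; rewrite /upd /= ?r7; lia.
Qed.

(** The postcondition speaks of acceptance only; the soundness of rejections is built into [wpr]. *)
Lemma ring_test_ok r m : r 7 = 0 -> m 0 = n -> tables m ->
    (forall a, 2 * (n * n) < a -> m a = 0) ->
  wpr ring_test (fun _ _ => is_ring add mul) r m.
Proof.
move=> r7 m0 tm mz.
apply/wp_seq/setup_ok => // {r7}r cr.
apply/wp_seq/check_addC_ok => // {cr}r cr addC.
apply: wp_seq; apply: (find_unit_ok (op := add)) => //.
- move=> r1 d x y X Y Q1 c1 dP; apply: wp_addlook => //.
  by case/andP: dP => /ltnW/ltnW-> ->.
- by case=> _ _ [o addo _] _ _; exists o => y; rewrite [add y o]addC addo.
move=> e {cr}r cr _ r8 eP.
have add0e : left_id e add by move=> y; have [] := eP y.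
apply: wp_seq; apply: (check_opp_ok (e := e)) => // r1 c1 fr1 addN.
have {}r8 : r1 8 = rk e by rewrite fr1.
apply: wp_seq; apply: (find_unit_ok (op := mul)) => //.
- by move=> r2 d x y X Y Q1 c2 dP; apply: wp_mullook.
- by case=> _ _ _ [_ [o mulo omul]] _; exists o => y; rewrite mulo omul.
move=> u r2 c2 fr2 _ uP.
have {}r8 : r2 8 = rk e by rewrite fr2.
apply: wp_seq; apply: (check_mul0_ok (e := e)) => // r3 c3 fr3 mul0.
have {}r8 : r3 8 = rk e by rewrite fr3.
apply: wp_seq; apply: (build_chain_ok (e := e)) => //.
move=> r4 m4 E G c4 [tm4 _ _ mG] r20 [_ _ assE disE] memE sp leG ringG.
have [_ _ c5 _ _] := c4.
apply: (check_mulA_ok (G := G) (e := e)) => //; first by rewrite c5.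
move=> _ assG.
(* Associativity comes first, since the distributivity clause of [good] presupposes it. *)
have addA : associative add by move=> x y z; rewrite assE.
have mDl : left_distributive mul add.
  by move=> x y z; have [] := disE addA x y (memE x) (memE y) z.
have mDr : right_distributive mul add.
  by move=> z x y; have [] := disE addA x y (memE x) (memE y) z.
split=> //; first by exists e.
split; first exact: (mulA_of_gens sp memE mul0 mDl mDr assG).
by exists u => y; have [] := uP y.
Qed.

End Correctness.

(** * Input encoding and running time *)

(** The deepest loop nests make [n * n], [4 * n * n] and [s * s * n] passes, the last at most
    [4 * n * n]. *)
Lemma cost_ring_test (n s : nat) : 0 < n -> s * s <= 4 * n ->
  cost (fun b => if b == 1 then n else if b == 6 then 4 * n else s) ring_test
  < 3000 * n ^ 2.
Proof.
move=> n_gt0 ss /=; rewrite -mulnn.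
(* For the lower-order terms in [s]. *)
have le_s : s <= 4 * n by nia.
have := leq_mul ss (leqnn n); have := leq_mul le_s (leqnn n).
have := leq_mul n_gt0 (leqnn n); have := leq_mul n_gt0 n_gt0.
by lia.
Qed.

Lemma nth_allpairs (S T U : Type) (f : S -> T -> U) s t x0 y0 z0 i j :
    i < size s -> j < size t ->
  nth z0 [seq f x y | x <- s, y <- t] (i * size t + j)
  = f (nth x0 s i) (nth y0 t j).
Proof.
elim: s i => // x s IH [|i] lt_i lt_j; rewrite allpairs_cons nth_cat size_map.
  by rewrite lt_j (nth_map y0).
by rewrite mulSn -addnA ltnNge leq_addr addKn IH.
Qed.

Section Input.

Variables (R : finType) (add mul : R -> R -> R).

Lemma size_cayley_table op : size (@cayley_table R op) = #|R| * #|R|.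
Proof. by rewrite size_allpairs -!cardE. Qed.

Lemma nth_cayley_table op (x y : R) :
  nth 0 (cayley_table op) (enum_rank x * #|R| + enum_rank y)
  = enum_rank (op x y).
Proof.
have := @nth_allpairs _ _ _ (fun x y => val (enum_rank (op x y)))
  (enum R) (enum R) x x 0 (enum_rank x) (enum_rank y).
by rewrite -!cardE !nth_enum_rank; apply; apply: ltn_ord.
Qed.

Lemma ring_input_tables : tables add mul (nth 0 (ring_input add mul)).
Proof.
split=> x y; rewrite addn1 ?addnS /= nth_cat size_cayley_table.
  by rewrite idx_lt nth_cayley_table.
by rewrite ltnNge leq_addl addnK nth_cayley_table.
Qed.

Lemma ring_input_default a : 2 * (#|R| * #|R|) < a ->
  nth 0 (ring_input add mul) a = 0.
Proof.
move=> lt_a; rewrite nth_default //= size_cat !size_cayley_table; lia.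
Qed.

End Input.

(** * From the deterministic run to success probabilities *)

Definition is_rand (i : instr) : bool := if i is Rand _ then true else false.

Definition deterministic (P : program) : bool := ~~ has is_rand P.

(** Only [Rand] consults the random word, so every tape yields the run on zeros. *)
Lemma foldl_deterministic P w s (tape : seq nat) : deterministic P ->
  foldl (step P w) s tape = iter (size tape) (fun s => step P w s 0) s.
Proof.
move=> detP; elim: tape s => // a tape IH s.
rewrite [size _]/= iterSr -IH /=; congr foldl.
case: s => //= pc reg mem.
have: ~~ is_rand (nth (Halt false) P pc).
  case: (ltnP pc (size P)) => [lt_pc|/(nth_default (Halt false)) -> //].
  move: detP; rewrite /deterministic -all_predC.
  by move/(all_nthP (Halt false)); apply.
by case: nth.
Qed.

Lemma iter_halted P w b t :
  iter t (fun s => step P w s 0) (Halted b) = Halted b.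
Proof. by elim: t => //= t ->. Qed.

Lemma wp_halts w bound Rej c (Goal : Prop) input t :
    wp w bound Rej c (fun _ _ => Goal) (fun=> 0) (nth 0 input) ->
    cost bound c < t ->
  exists2 b : bool,
    iter t (fun s => step (compile c 0 ++ [:: Halt true]) w s 0) (init input)
      = Halted b & if b then Goal else Rej.
Proof.
move=> /(_ [::] [:: Halt true]) [u le_u Hu] lt_t.
(* After [u] steps the run has left the compiled code or rejected. One more step executes the
   closing [Halt true], and the rest idle; the strict bound on [cost] leaves room for that step. *)
have -> : t = (t - u.+1 + 1) + u by lia.
rewrite !iterD; move: Hu; rewrite cat0s; set P := _ ++ _.
have endP : nth (Halt false) P (csize c) = Halt true.
  by rewrite -(size_compile c 0) nth_code.
case: (iter u _ _) => [pc reg mem [-> G]|b [-> nG]].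
  by exists true => //; rewrite iterSr /= add0n endP iter_halted.
by exists false; rewrite //= iter_halted.
Qed.

Lemma run_ring_program (R : finType) (add mul : R -> R -> R) w
    (tape : (3000 * #|R| ^ 2).-tuple 'I_(2 ^ w)) :
    0 < #|R| -> 2 * (#|R| * #|R|) + 4 * #|R| + 1 < 2 ^ w ->
  exists2 b, run ring_program (ring_input add mul) tape = Some b &
    if b then is_ring add mul else ~ is_ring add mul.
Proof.
move=> n_gt0 wP; have [s ss sP] := ex_sqrt_bound (4 * #|R|).
have test := ring_test_ok n_gt0 wP sP (r := fun=> 0) erefl erefl
  (ring_input_tables add mul) (@ring_input_default R add mul).
have [b haltP Hb] := wp_halts test (cost_ring_test n_gt0 ss).
exists b => //.
(* That [ring_program] contains no [Rand] is settled by evaluation. *)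
by rewrite /run foldl_deterministic // size_map size_tuple haltP.
Qed.

Lemma prob_answer1 P w T input b :
    (forall tape : T.-tuple 'I_(2 ^ w), run P input tape = Some b) ->
  prob_answer P w T input b = 1%R.
Proof.
move=> H; rewrite /prob_answer (_ : [set _ | _] = setT); last first.
  by apply/setP => tape; rewrite !inE H eqxx.
rewrite cardsT GRing.divff // Num.Theory.pnatr_eq0 card_tuple card_ord.
by rewrite -lt0n !expn_gt0.
Qed.

(** With [a] the power of two just above [n], words range over at least [a ^ 4] values, and
    [a ^ 4 >= 4 * a ^ 2 >= 4 * (n + 1) ^ 2] as [a >= 2]. *)
Lemma word_size_bound k n : 0 < n -> 4 <= k ->
  2 * (n * n) + 4 * n + 1 < 2 ^ word_size k n.
Proof.
move=> n_gt0 k4; apply: leq_trans (leq_pexp2l (isT : 0 < 2) (leq_mul k4 (leqnn _))).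
rewrite (mulnC 4 _.+1) expnM; have := trunc_log_ltn n (isT : 1 < 2).
move: (2 ^ _) => a lt_n; rewrite -[a ^ 4]/(a ^ (2 + 2)) expnD -mulnn.
have le1 : n.+1 * n.+1 <= a * a by apply: leq_mul.
have : 4 * (a * a) <= a * a * (a * a) by rewrite leq_mul2r; nia.
by lia.
Qed.

Theorem theorem1p6 :
  exists k0 : nat, forall k c : nat, (k0 <= k)%N ->
  exists (P : program) (C : nat),
  forall (R : finType) (add mul : R -> R -> R), (0 < #|R|)%N ->
  let n := #|R| in
  let w := word_size k n in
  let T := (C * n ^ 2)%N in
  let input := ring_input add mul in
  (forall tape : T.-tuple 'I_(2 ^ w), run P input tape <> None) /\
  (is_ring add mul -> (1 - n%:R ^- c <= prob_answer P w T input true)%R) /\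
  (~ is_ring add mul -> (1 - n%:R ^- c <= prob_answer P w T input false)%R).
Proof.
(* Neither the program nor the constant depends on [k] or [c]: the answer is always right, so its
   probability is 1. *)
exists 4 => k c k4; exists ring_program, 3000 => R add mul n_gt0 n w T input.
have runP (tape : T.-tuple 'I_(2 ^ w)) := run_ring_program add mul tape n_gt0
  (word_size_bound n_gt0 k4).
have bnd : (1 - n%:R ^- c <= 1 :> rat)%R.
  by rewrite Num.Theory.gerBl Num.Theory.invr_ge0 Num.Theory.exprn_ge0 ?Num.Theory.ler0n.
split=> [tape|]; first by have [b ->] := runP tape.
by split=> H; rewrite prob_answer1 // => tape; have [[] ->] := runP tape.
Qed.
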